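(* Let $V$ be a finite-dimensional complex vector space and let $T : V \to V$ be a linear operator. If $V \neq \{0\}$, then there exist $\bar{v} \in V \setminus \{0\}$ and $\bar{\lambda} \in \mathbb{C}$ such that $$T(\bar{v}) = \bar{\lambda}\, \bar{v}.$$ *)

(* Defs.v *)
From mathcomp Require Import all_boot all_order all_algebra.
From mathcomp Require Import reals complex.

(* [R : realType] is a (Dedekind-complete, archimedean) field of real numbers,
   unique up to isomorphism, so [R[i]] is the field of complex numbers. *)

(* Main.v *)
Require Import Defs.
From mathcomp Require Import all_boot all_order all_algebra.
From mathcomp Require Import reals complex.
Import GRing.Theory passmx.
Local Open Scope ring_scope.
Local Open Scope complex_scope.

(** In a basis, [T] is a square matrix of size [\dim V], whose characteristic
    polynomial has degree [\dim V].  As [V] is nonzero this polynomial is not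
    constant, so over an algebraically closed field it has a root [a]; the
    matrix then has an eigenvector for [a], and the vector of [V] with these
    coordinates is one for [T].  This is [closed_field_eigenvector]; it applies
    to [R[i]], which is algebraically closed because [R] is real closed. *)

Lemma closed_field_eigenvector (F : closedFieldType) (V : vectType F)
    (T : {linear V -> V}) :
  {:V}%VS != 0%VS -> exists2 v : V, v != 0 & exists a : F, T v = a *: v.
Proof.
move=> nzV; pose e := vbasis {:V}; pose A := mxof e e (linfun T).
have eP : basis_of {:V} e := vbasisP _.
have [|a] := closed_rootP (char_poly A) _.
  by rewrite size_char_poly eqSS dimv_eq0.
rewrite -eigenvalue_root_char => /eigenvalueP[u uA nz_u].
exists (vecof e u); first by rewrite vecof_eq0.
exists a; rewrite -[T _]lfunE (hom_vecof _ eP).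
by rewrite uA linearZ.
Qed.

Theorem theorem1 (R : realType) (V : vectType R[i]) (T : {linear V -> V})
    (hV : {:V}%VS <> 0%VS) :
  exists (v : V) (lambda : R[i]), v <> 0 /\ T v = lambda *: v.
Proof.
have [|v /eqP nz_v [a Tv]] := closed_field_eigenvector _ V T; first exact/eqP.
by exists v, a.
Qed.
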